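(* Let $n=2^k+r$ with integers $k\ge 0$ and $0\le r<2^k$, and let $n=\sum_{i=0}^k n_i2^i$ with $n_i\in\{0,1\}$ be its binary expansion. Then $$\tau\left(\frac{r}{2^k}\right)=\frac{1}{2^k}\sum_{i=0}^{k-1}\lambda_i(n),\quad\text{where } \lambda_i(n)=\begin{cases}(n\bmod 2^i), & \text{if } n_i=0;\\ 2^i-(n\bmod 2^i), & \text{if } n_i=1.\end{cases}$$ An explicit form is $$\tau\left(\frac{r}{2^k}\right)=\frac{1}{2^k}\sum_{i=0}^{k-1}\left(n_i\cdot 2^i+(-1)^{n_i}\cdot(n\bmod 2^i)\right).$$
   Context: $\tau$ denotes the Takagi function on $[0,1]$, a continuous function. On dyadic rationals it is given as follows: for integers $k\ge 0$ and $0\le N<2^{k+1}$ with binary digits $N=\sum_{i=0}^{k}N_i2^i$, $N_i\in\{0,1\}$, and $N_i=0$ for every negative integer $i$, $\tau\left(\frac{N}{2^{k+1}}\right)=\sum_{i=1}^\infty \frac{\ell_i(N)}{2^i}$, where for $i\ge 0$, $\ell_{i+1}(N)=\sum_{j=0}^{i-1}N_{k-j}$ if $N_{k-i}=0$, and $\ell_{i+1}(N)=i-\sum_{j=0}^{i-1}N_{k-j}$ if $N_{k-i}=1$. (Equivalently, $\tau(x)=\sum_{m=0}^\infty 2^{-m}\,\mathrm{dist}(2^m x,\mathbb{Z})$ for $x\in[0,1]$.) Here $n\bmod 2^i$ is the remainder in $\{0,\dots,2^i-1\}$; empty sums are $0$. *)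

(* Defs.v *)
From mathcomp Require Import all_boot all_order all_algebra.
From mathcomp Require Import all_classical all_reals all_analysis.
Set Implicit Arguments.
Unset Strict Implicit.
Unset Printing Implicit Defensive.
Import Order.TTheory GRing.Theory Num.Theory.
Import numFieldNormedType.Exports.
Local Open Scope ring_scope.

(* The coefficient n_i of 2^i in the binary expansion of n. *)
Definition bit (n i : nat) : nat := (n %/ 2 ^ i %% 2)%N.

(* For 0 <= x < 1, [digit x i] is the coefficient of 2^-(i+1) in the binary
   expansion of x; a dyadic rational gets its terminating expansion. At x = 1
   every digit is 0, which gives the correct value [takagi 1 = 0]. *)
Definition digit (R : realType) (x : R) (i : nat) : nat :=
  (Num.truncn (2 ^+ i.+1 * x) %% 2)%N.

(* [ell a i] is l_{i+1} for the 0/1 digit sequence a: the number of j < i with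
   a_j != a_i. For 0/1 digits the truncated subtraction is exact. *)
Definition ell (a : nat -> nat) (i : nat) : nat :=
  if a i == 0%N then (\sum_(j < i) a j)%N else (i - \sum_(j < i) a j)%N.

(* The Takagi function on [0, 1], by Takagi's digit formula
   tau(x) = \sum_(i >= 1) l_i / 2^i (index shifted by one). *)
Definition takagi (R : realType) (x : R) : R :=
  limn (series (fun i => (ell (digit x) i)%:R / 2 ^+ i.+1 : R)).

Definition lambda (n i : nat) : nat :=
  if bit n i == 0%N then (n %% 2 ^ i)%N else (2 ^ i - n %% 2 ^ i)%N.

(* N_(k-i), with the convention that N_j = 0 for j < 0. *)
Definition bit_from_top (N k i : nat) : nat :=
  if (i <= k)%N then bit N (k - i) else 0%N.

Lemma digit_dyadic (R : realType) (k N : nat) :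
  digit (N%:R / 2 ^+ k.+1 : R) =1 bit_from_top N k.
Proof.
move=> i; rewrite /digit /bit_from_top /bit.
have [le_ik|lt_ki] := leqP i k; last first.
  have -> : 2 ^+ i.+1 * (N%:R / 2 ^+ k.+1) = (2 ^ (i - k) * N)%:R :> R.
    have -> : i.+1 = (i - k + k.+1)%N by rewrite addnS subnK // ltnW.
    by rewrite exprD natrM natrX mulrCA mulfK ?expf_neq0 ?pnatr_eq0 1?mulrC.
  rewrite natrK; apply/eqP; rewrite -/(dvdn 2 _) dvdn_mulr //.
  by rewrite -subn_gt0 in lt_ki; rewrite dvdn_exp.
have -> : 2 ^+ i.+1 * (N%:R / 2 ^+ k.+1) = N%:R / (2 ^ (k - i))%:R :> R.
  have -> : k.+1 = (k - i + i.+1)%N by rewrite addnS subnK.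
  rewrite exprD natrX invfM mulrCA; congr (_ * _).
  by rewrite mulrCA divff ?expf_neq0 ?pnatr_eq0 // mulr1.
congr (_ %% 2)%N; apply: truncn_def.
have d_gt0 : 0 < (2 ^ (k - i))%:R :> R by rewrite ltr0n expn_gt0.
rewrite ler_pdivlMr // ltr_pdivrMr // -!natrM ler_nat ltr_nat.
by rewrite leq_divM ltn_ceil // expn_gt0.
Qed.

Lemma takagi_dyadic (R : realType) (k N : nat) :
  takagi (N%:R / 2 ^+ k.+1 : R) =
  limn (series (fun i => (ell (bit_from_top N k) i)%:R / 2 ^+ i.+1 : R)).
Proof.
by rewrite /takagi (_ : digit _ = bit_from_top N k) //; apply/funext/digit_dyadic.
Qed.

(* Main.v *)
Require Import Defs.
From mathcomp Require Import all_boot all_order all_algebra.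
From mathcomp Require Import all_classical all_reals all_analysis.
From mathcomp Require Import zify ring.
Import Order.TTheory GRing.Theory Num.Theory.
Import numFieldNormedType.Exports.
Local Open Scope ring_scope.

(** Both sides count the same thing: pairs of distinct binary digits of [r],
    weighted by a power of 2.

    For a 0/1 sequence [a], [ell a i] is the number of earlier digits different
    from [a i] ([ell_card]).  The digits of [r / 2 ^ k] are the [k] low bits of
    [r] read downwards, followed by zeros.  After multiplication by [2 ^ k], the
    first [k] terms of the series for [takagi] give each pair of positions
    [m < i < k] with distinct bits the weight [2 ^ m], since reading downwards
    turns the later position of a pair into the lower bit [m].  The remaining
    terms all have [ell] equal to the digit sum [s] of [r], and the geometric
    series contributes [s] in total ([takagi_finite_digits]).

    On the other side, [n %% 2 ^ i] is the sum of [2 ^ m] over the one bits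
    [m < i], and [2 ^ i - n %% 2 ^ i] is one more than the sum of [2 ^ m] over
    the zero bits [m < i].  So [lambda n i] is [bit n i] plus the sum of [2 ^ m]
    over the [m < i] at which the bit differs from that at [i] ([lambda_sum]);
    summing over [i < k] gives the digit sum plus the same weighted count of
    pairs ([sum_ell_rev]).  The leading bit [2 ^ k] of [n] affects no
    [lambda n i] with [i < k]. *)

Lemma bit_le1 n i : (bit n i <= 1)%N.
Proof. by rewrite /bit -ltnS ltn_pmod. Qed.

Lemma modn_exp2S n i : (n %% 2 ^ i.+1 = bit n i * 2 ^ i + n %% 2 ^ i)%N.
Proof.
have p_gt0 : (0 < 2 ^ i)%N by rewrite expn_gt0.
have lt_mod := ltn_pmod n p_gt0; have le_bit := bit_le1 n i.
rewrite {1}(divn_eq n (2 ^ i)) {1}(divn_eq (n %/ 2 ^ i) 2) -/(bit n i).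
rewrite mulnDl -mulnA -expnS -addnA modnMDl modn_small // expnS.
nia.
Qed.

Lemma lambda_add_exp2 r k i : (i < k)%N -> lambda (2 ^ k + r) i = lambda r i.
Proof.
move=> lt_ik; rewrite /lambda /bit.
have -> : (2 ^ k = 2 ^ (k - i.+1) * 2 * 2 ^ i)%N.
  by rewrite -mulnA -expnS -expnD subnK.
by rewrite modnMDl divnMDl ?expn_gt0 // modnMDl.
Qed.

Lemma ell_card (a : nat -> nat) i : (forall j, (a j <= 1)%N) ->
  ell a i = (\sum_(j < i) (a j != a i))%N.
Proof.
move=> a01; rewrite /ell.
have sumC m : (\sum_(j < m) a j + \sum_(j < m) (a j == 0) = m)%N.
  rewrite -big_split -[RHS]card_ord -sum1_card; apply: eq_bigr => j _ /=.
  by move: (a01 j); case: (a j) => [|[]].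
have := a01 i; case: (a i) => [|[|//]] _ /=.
  by apply: eq_bigr => j _; move: (a01 j); case: (a j) => [|[]].
rewrite -{1}(sumC i) addKn; apply: eq_bigr => j _.
by move: (a01 j); case: (a j) => [|[]].
Qed.

(** The extra [bit n i] is the 1 in [2 ^ i = 1 + \sum_(m < i) 2 ^ m], which
    enters when the remainder is complemented. *)
Lemma lambda_sum n i :
  lambda n i = (bit n i + \sum_(m < i) (bit n m != bit n i) * 2 ^ m)%N.
Proof.
rewrite /lambda.
have modE p : (n %% 2 ^ p = \sum_(m < p) bit n m * 2 ^ m)%N.
  elim: p => [|p IH]; rewrite ?big_ord0 ?modn1 //.
  by rewrite big_ord_recr /= -IH modn_exp2S addnC.
have sumC p : (\sum_(m < p) bit n m * 2 ^ m
                + (\sum_(m < p) (bit n m == 0) * 2 ^ m).+1 = 2 ^ p)%N.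
  elim: p => [|p IH]; first by rewrite !big_ord0.
  rewrite !big_ord_recr /= expnS -{}IH.
  by have := bit_le1 n p; case: (bit n p) => [|[|//]] _ /=; lia.
have := bit_le1 n i; case: (bit n i) => [|[|//]] _ /=.
  rewrite modE add0n; apply: eq_bigr => m _; congr (_ * _)%N.
  by have := bit_le1 n m; case: (bit n m) => [|[]].
rewrite modE -{1}(sumC i) addKn; congr _.+1.
apply: eq_bigr => m _; congr (_ * _)%N.
by have := bit_le1 n m; case: (bit n m) => [|[]].
Qed.

Definition digit_of_ratio (r k i : nat) : nat :=
  if (i < k)%N then bit r (k - i.+1) else 0%N.

Lemma digit_of_ratio_le1 r k i : (digit_of_ratio r k i <= 1)%N.
Proof. by rewrite /digit_of_ratio; case: ifP => // _; apply: bit_le1. Qed.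

(** Writing the argument as [2 * r / 2 ^ k.+1] also covers [k = 0]; the added
    last bit is 0. *)
Lemma digit_ratio (R : realType) (r k : nat) :
  digit (r%:R / 2 ^+ k : R) =1 digit_of_ratio r k.
Proof.
have -> : r%:R / 2 ^+ k = (2 * r)%N%:R / 2 ^+ k.+1 :> R.
  by rewrite natrM exprS invfM mulrACA divff ?mul1r ?pnatr_eq0.
move=> i; rewrite digit_dyadic /bit_from_top /digit_of_ratio.
case: ltngtP => [lt_ik|//|->]; last by rewrite subnn /bit divn1 modnMr.
by rewrite -(subnSK lt_ik) /bit expnS divnMl.
Qed.

(** Once the digits have become 0, every term is [s / 2 ^ i.+1], where [s] is the
    sum of the digits; the tail from [k] on is therefore [s / 2 ^ k]. *)
Lemma takagi_finite_digits (R : realType) (x : R) (a : nat -> nat) (k : nat) :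
  digit x =1 a -> (forall i, (k <= i)%N -> a i = 0%N) ->
  takagi x * 2 ^+ k = (\sum_(i < k) ell a i * 2 ^ (k - i.+1) + \sum_(i < k) a i)%:R.
Proof.
move=> /funext digitE a0; rewrite /takagi digitE.
set s := (\sum_(i < k) a i)%N.
set H : R := \sum_(0 <= i < k) (ell a i)%:R / 2 ^+ i.+1.
have two_neq0 p : 2 ^+ p != 0 :> R by rewrite expf_neq0 ?pnatr_eq0.
have sE m : (k <= m)%N -> (\sum_(j < m) a j)%N = s.
  move=> /subnKC <-; rewrite big_split_ord /= [X in (_ + X)%N]big1 ?addn0 // => j _.
  by rewrite a0 // leq_addr.
have partial m : series (fun i => (ell a i)%:R / 2 ^+ i.+1 : R) (m + k)%N
    = H + s%:R / 2 ^+ k - s%:R / 2 ^+ k * (2^-1) ^+ m.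
  elim: m => [|m IH]; first by rewrite expr0 mulr1 addrK.
  rewrite addSn seriesS IH /ell a0 ?leq_addl // eqxx sE ?leq_addl //.
  rewrite -addSn exprD !exprVn exprS; field.
  by rewrite !two_neq0.
have lim : limn (series (fun i => (ell a i)%:R / 2 ^+ i.+1 : R)) = H + s%:R / 2 ^+ k.
  apply/cvg_lim => //; rewrite -(cvg_shiftn k) /=.
  under eq_fun do rewrite partial.
  have : ((fun m => H + s%:R / 2 ^+ k - s%:R / 2 ^+ k * 2^-1 ^+ m) @ \oo
          --> H + s%:R / 2 ^+ k - s%:R / 2 ^+ k * 0)%classic.
    apply: cvgB; first exact: cvg_cst.
    apply: cvgM; first exact: cvg_cst.
    by apply: cvg_expr; rewrite ger0_norm ?invr_ge0 // invf_lt1 ?ltr1n.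
  by rewrite mulr0 subr0.
rewrite lim mulrDl mulfVK // natrD; congr (_ + _).
rewrite /H big_mkord natr_sum mulr_suml; apply: eq_bigr => i _.
have -> : 2 ^+ k = 2 ^+ i.+1 * 2 ^+ (k - i.+1) :> R by rewrite -exprD subnKC.
by rewrite natrM natrX mulrA mulfVK.
Qed.

(** A pair [j < i] of positions counted from the top is the pair
    [k - i.+1 < k - j.+1] of bit positions, so the weight [2 ^ (k - i.+1)] is that
    of the lower bit: reversing both indices and exchanging the sums turns one
    count of the pairs into the other. *)
Lemma sum_ell_rev (r k : nat) :
  (\sum_(i < k) ell (digit_of_ratio r k) i * 2 ^ (k - i.+1)
   + \sum_(i < k) digit_of_ratio r k i = \sum_(i < k) lambda r i)%N.
Proof.
have digit_rev (i : 'I_k) : digit_of_ratio r k (rev_ord i) = bit r i.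
  by rewrite /digit_of_ratio ltn_ord /= subnSK // subKn // ltnW.
under [RHS]eq_bigr do rewrite lambda_sum.
rewrite big_split /= addnC; congr (_ + _)%N.
  by rewrite (reindex_inj rev_ord_inj); apply: eq_bigr => i _; rewrite digit_rev.
under eq_bigr => i _ do
  rewrite (ell_card _ _ (digit_of_ratio_le1 r k))
    (big_ord_widen k (fun j => digit_of_ratio r k j != digit_of_ratio r k i : nat)
      (ltnW (ltn_ord i))) big_distrl /=.
under [RHS]eq_bigr => i _ do
  rewrite (big_ord_widen k (fun m => (bit r m != bit r i) * 2 ^ m)%N
    (ltnW (ltn_ord i))).
rewrite (exchange_big_dep xpredT) //= (reindex_inj rev_ord_inj).
apply: eq_bigr => i _; rewrite (reindex_inj rev_ord_inj).
apply: eq_big => [j|j _] /=; first by have := ltn_ord i; lia.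
rewrite -[(k - j.+1)%N]/(rev_ord j : nat) !digit_rev subnSK //.
by rewrite subKn 1?ltnW // eq_sym.
Qed.

Theorem theorem25 (R : realType) (k n r : nat)
    (hr : (r < 2 ^ k)%N) (hn : n = (2 ^ k + r)%N) :
  takagi (r%:R / 2 ^+ k : R) =
    1 / 2 ^+ k * \sum_(0 <= i < k) (lambda n i)%:R
  /\
  takagi (r%:R / 2 ^+ k : R) =
    1 / 2 ^+ k * \sum_(0 <= i < k)
      ((bit n i)%:R * 2 ^+ i + (-1) ^+ bit n i * (n %% 2 ^ i)%N%:R).
Proof.
have main : takagi (r%:R / 2 ^+ k : R)
    = 1 / 2 ^+ k * \sum_(0 <= i < k) (lambda n i)%:R.
  have two_neq0 : 2 ^+ k != 0 :> R by rewrite expf_neq0 ?pnatr_eq0.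
  apply: (mulIf two_neq0).
  rewrite (takagi_finite_digits _ _ _ _ (digit_ratio R r k)).
  - rewrite sum_ell_rev mul1r mulrC mulVKf // natr_sum big_mkord.
    by apply: eq_bigr => i _; rewrite hn lambda_add_exp2.
  - by move=> i; rewrite /digit_of_ratio ltnNge => ->.
split=> //; rewrite main; congr (_ * _); apply: eq_bigr => i _; rewrite /lambda.
have := bit_le1 n i; case: (bit n i) => [|[|//]] _ /=.
  by rewrite mul0r add0r expr0 mul1r.
by rewrite natrB ?natrX ?mul1r ?expr1 ?mulN1r // ltnW // ltn_pmod // expn_gt0.
Qed.
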